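(* Let $G$ be a Hausdorff topological group with identity $e$ and let $t\in G$ with $t\neq e$. Suppose there exists a symmetric neighborhood $V$ of $e$ in $G$ such that (1) $tV^3\cap V^3=\emptyset$, and (2) $V^3tV^3t^{-1}\cup V^3t^{-1}V^3t$ can be covered by a finite number of right translates $Vg$ ($g\in G$) of $V$. Then the canonical action $G\times G^{\mathrm{LUC}}\to G^{\mathrm{LUC}}$ is $t$-free; that is, $tx\neq x$ for all $x\in G^{\mathrm{LUC}}$. Consequently, if $G$ is locally quasi-totally bounded, then $G$ acts freely on $G^{\mathrm{LUC}}$, and the universal compact ambit of $G$ and the universal minimal compact flow of $G$ are both free.
   Context: For a function $f:G\to\mathbb{C}$ and $t\in G$ let $(ft)(x)=f(tx)$. $\mathrm{LUC}(G)$ is the set of bounded continuous $f:G\to\mathbb{C}$ such that $ft_n\to ft$ in the supremum norm whenever $t_n\to t$ is a convergent net in $G$ (equivalently: for each $\varepsilon>0$ there is a neighborhood $V$ of $e$ with $|f(x)-f(vx)|<\varepsilon$ for all $x\in G$, $v\in V$). For $t\in G$ let $t^*\in \mathrm{LUC}(G)^*$ be evaluation $f\mapsto f(t)$. $G^{\mathrm{LUC}}$ is the weak-$*$ closure of $\{t^*: t\in G\}$ in the dual space $\mathrm{LUC}(G)^*$, with the weak-$*$ topology (a compact Hausdorff space); the canonical action is $(t\mu)(f)=\mu(ft)$, which is jointly continuous. $G$ is called locally quasi-totally bounded if for every $t\in G$ with $t\neq e$ there exists a symmetric neighborhood $V$ of $e$ such that $tV^3\cap V^3=\emptyset$ and $V^3tV^3t^{-1}\cup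 V^3t^{-1}V^3t$ can be covered by finitely many right translates of $V$. A compact flow of $G$ is a jointly continuous action of $G$ on a compact Hausdorff space $X$. A compact ambit is a compact flow together with a base point whose orbit is dense. A factor of a flow is its image under a continuous surjective $G$-equivariant map (preserving base points in the case of ambits). A compact ambit is universal if every compact ambit of $G$ is a factor of it; a minimal compact flow is universal if every minimal compact flow of $G$ is a factor of it. An action of $G$ on $X$ is free if $tx=x$ for some $x\in X$ implies $t=e$. *)

(* Defs.v *)
From HB Require Import structures.
From mathcomp Require Import all_boot all_order all_algebra.
From mathcomp Require Import complex.
From mathcomp Require Import all_classical all_reals all_analysis.

Set Implicit Arguments.
Unset Strict Implicit.
Unset Printing Implicit Defensive.

Import Order.TTheory GRing.Theory Num.Theory.
Local Open Scope classical_set_scope.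
Local Open Scope ring_scope.
Local Open Scope complex_scope.

HB.structure Definition PreTopologicalGroup :=
  {G of Topological G & Group G}.

HB.mixin Record PreTopologicalGroup_isTopologicalGroup G
    & PreTopologicalGroup G := {
  mulg_continuous : continuous (fun x : G * G => (x.1 * x.2)%g) ;
  invg_continuous : continuous (fun x : G => x^-1%g)
}.

#[short(type="topologicalGroupType")]
HB.structure Definition TopologicalGroup :=
  {G of PreTopologicalGroup G & PreTopologicalGroup_isTopologicalGroup G}.

Section SetProducts.
Context {G : topologicalGroupType}.
Implicit Types (A B V : set G) (t g : G).

Definition mul_set A B : set G := [set (a * b)%g | a in A & b in B].
Definition inv_set A : set G := [set a^-1%g | a in A].
Definition ltrans t A : set G := [set (t * a)%g | a in A].
Definition rtrans A g : set G := [set (a * g)%g | a in A].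
Definition cube V : set G := mul_set (mul_set V V) V.

Definition symmetric_nbhs V := nbhs (1%g : G) V /\ inv_set V = V.

Definition qtb_at t V :=
  ltrans t (cube V) `&` cube V = set0 /\
  exists2 F : set G, finite_set F &
    rtrans (mul_set (rtrans (cube V) t) (cube V)) t^-1%g `|`
    rtrans (mul_set (rtrans (cube V) t^-1%g) (cube V)) t
      `<=` \bigcup_(g in F) rtrans V g.

End SetProducts.

Definition locally_qtb (G : topologicalGroupType) :=
  forall t : G, t <> 1%g -> exists2 V : set G, symmetric_nbhs V & qtb_at t V.

Lemma mulgl_continuous (G : topologicalGroupType) (t : G) :
  continuous (fun x : G => (t * x)%g).
Proof.
move=> x; apply: (@continuous_comp _ _ _ (fun x => (t, x)) (fun p => p.1 * p.2)%g).
  by apply: cvg_pair => /=; [exact: cvg_cst|exact: cvg_id].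
exact: mulg_continuous.
Qed.

Section LUC.
Context {R : realType} {G : topologicalGroupType}.
(* the modulus topology of R[i] is an instance on R[i]^o *)
Local Notation C := (R[i]^o).
Implicit Types (f : G -> C) (t x : G).

(* the function written ft *)
Definition ltranslate f t : G -> C := fun x => f (t * x)%g.

(* On bounded functions the topology of {uniform G -> C} is that of the
   supremum norm; continuity of t |-> ft for it is convergence ft_n --> ft
   along every net t_n --> t. *)
Definition is_luc f :=
  [/\ exists M : R[i], forall x, `|f x| <= M,
      continuous f &
      continuous (ltranslate f : G -> {uniform G -> C})].

Definition luc_pred : {pred G -> C} := mem [set f | is_luc f].

Lemma uniform_cvgP (T : topologicalType) (h : T -> G -> C) (s : T) :
  (h : T -> {uniform G -> C}) @ s --> (h s : {uniform G -> C}) <->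
  forall e : R[i], 0 < e -> \forall u \near s, forall x, `|h s x - h u x| < e.
Proof.
split=> [H e e0|H P /uniform_nbhs [E [entE subP]]].
  have : nbhs (h s : {uniform G -> C}) [set k | forall x, `|h s x - k x| < e].
    apply/uniform_nbhs; exists [set z | ball z.1 e z.2]; split.
      exact: (@entourage_ball _ C (PosNum e0)).
    by move=> k /= K x; exact: K.
  by move/H.
move: entE; rewrite -entourage_ballE => -[e /= e0 eE].
apply: (filterS _ (H e e0)) => u Hu; apply: subP => y _.
by apply: eE => /=; exact: Hu.
Qed.

Lemma luc_submod_closed : submod_closed luc_pred.
Proof.
split.
  rewrite inE; split; first by exists 0 => x; rewrite normr0.
    exact: (@cst_continuous _ C).
  move=> t; apply/uniform_cvgP => e e0; near=> u => x.
  by rewrite /ltranslate subr0 normr0.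
move=> a f g; rewrite !inE => -[[M fM] cf lf] [[N gN] cg lg]; split.
- exists (`|a| * M + N) => x.
  rewrite (le_trans (ler_normD _ _))// lerD// normrM.
  by rewrite ler_wpM2l.
- by move=> x; apply: (@cvgD _ C); [apply: (@cvgZr _ C); exact: cf|exact: cg].
- move=> t; apply/uniform_cvgP => e e0.
  have /uniform_cvgP lft := lf t; have /uniform_cvgP lgt := lg t.
  have e1 : 0 < e / 2 / (`|a| + 1).
    by rewrite divr_gt0 ?divr_gt0// ltr_wpDl.
  have e2 : 0 < e / 2 by rewrite divr_gt0.
  near=> u => x.
  have F : `|f (t * x)%g - f (u * x)%g| < e / 2 / (`|a| + 1).
    by move: x; near: u; exact: lft.
  have K : `|g (t * x)%g - g (u * x)%g| < e / 2.
    by move: x F; near: u; apply: filterS (lgt _ e2) => u + x _; exact.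
  rewrite /ltranslate /= [X in `|X|](_ : _ = a * (f (t * x)%g - f (u * x)%g) +
    (g (t * x)%g - g (u * x)%g)); last first.
    by rewrite mulrBr opprD addrACA.
  rewrite (le_lt_trans (ler_normD _ _))// normrM [ltRHS](splitr e).
  rewrite ler_ltD// (le_trans (ler_wpM2l _ (ltW F)))//.
  by rewrite mulrCA ger_pMr// ler_pdivrMr ?ltr_wpDl// mul1r lerDl.
Unshelve. all: by end_near. Qed.

HB.instance Definition _ :=
  GRing.isSubmodClosed.Build _ _ luc_pred luc_submod_closed.

Record LUC := MkLUC { luc_fun :> G -> C; _ : luc_fun \in luc_pred }.

HB.instance Definition _ := [isSub for luc_fun].
HB.instance Definition _ := [Choice of LUC by <:].
HB.instance Definition _ := [SubChoice_isSubLmodule of LUC by <:].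

Lemma lucP (f : LUC) : is_luc f.
Proof. by have := valP f; rewrite inE. Qed.

(* LUC(G) with the topology of its supremum norm *)
HB.instance Definition _ := Topological.copy LUC
  (initial_topology (luc_fun : LUC -> {uniform G -> C})).

Lemma luc_cvgP (T : topologicalType) (h : T -> LUC) (s : T) :
  h @ s --> h s <->
  forall e : R[i], 0 < e -> \forall u \near s, forall x, `|h s x - h u x| < e.
Proof.
rewrite -(uniform_cvgP (fun u => luc_fun (h u)) s); split=> H.
  apply: (@cvg_comp _ _ _ h (luc_fun : LUC -> {uniform G -> C}) _ _ _ H).
  exact: (@initial_continuous _ {uniform G -> C} luc_fun).
move=> P hP; rewrite nbhsE in hP; case: hP => _ [[B oB <-] /= Bs] BP.
have HB := H B (open_nbhs_nbhs (conj oB Bs)).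
apply: (@filterS T (nbhs s) (nbhs_filter s) ((luc_fun \o h) @^-1` B)) => // u.
exact: BP.
Qed.

Lemma ltranslate_luc (f : LUC) t : ltranslate f t \in luc_pred.
Proof.
rewrite inE; have [[M fM] cf lf] := lucP f; split.
- by exists M => x; exact: fM.
- move=> x; apply: (@continuous_comp _ _ C (fun y : G => (t * y)%g) f).
    exact: mulgl_continuous.
  exact: cf.
- move=> s; rewrite (_ : ltranslate _ = ltranslate f \o (fun s => t * s)%g).
    apply: (@continuous_comp _ _ {uniform G -> C} (fun s : G => (t * s)%g)).
      exact: mulgl_continuous.
    exact: lf.
  by apply/funext => u; apply/funext => x; rewrite /ltranslate /= mulgA.
Qed.

Definition luc_translate (f : LUC) t : LUC := MkLUC (ltranslate_luc f t).

(* LUC(G)^*, the continuous linear functionals *)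
Record LUC_dual := MkLUC_dual {
  dual_fun :> LUC -> C ;
  dual_scalar : scalar dual_fun ;
  dual_continuous : continuous dual_fun }.

HB.instance Definition _ := gen_eqMixin LUC_dual.
HB.instance Definition _ := gen_choiceMixin LUC_dual.

(* the weak-* topology *)
HB.instance Definition _ := Topological.copy LUC_dual
  (initial_topology (dual_fun : LUC_dual -> {ptws LUC -> C})).

Lemma point_eval_scalar t : scalar (fun f : LUC => f t : C).
Proof. by []. Qed.

Lemma point_eval_continuous t : continuous (fun f : LUC => f t : C).
Proof.
move=> f; have /(@luc_cvgP LUC id f) H : id @ f --> id f by exact: cvg_id.
apply/(@cvgrPdist_lt _ C LUC (nbhs f) (nbhs_filter f)) => e e0.
by apply: (@filterS _ _ (nbhs_filter f) _ _ _ (H e e0)) => g; exact.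
Qed.

Definition point_eval t : LUC_dual := MkLUC_dual (@point_eval_scalar t) (@point_eval_continuous t).

Lemma act_scalar t (mu : LUC_dual) : scalar (fun f : LUC => mu (luc_translate f t) : C).
Proof.
move=> a f g; rewrite -dual_scalar; congr (mu _).
by apply/val_inj.
Qed.

Lemma act_continuous t (mu : LUC_dual) :
  continuous (fun f : LUC => mu (luc_translate f t) : C).
Proof.
move=> f; apply: (@cvg_comp _ _ _ (luc_translate^~ t) mu _ (nbhs (luc_translate f t))).
  apply/(luc_cvgP (luc_translate^~ t)) => e e0.
  have /(@luc_cvgP LUC id f) H : id @ f --> id f by exact: cvg_id.
  by apply: (@filterS _ _ (nbhs_filter f) _ _ _ (H e e0)) => g + x; exact.
exact: dual_continuous.
Qed.

Definition dual_act t (mu : LUC_dual) : LUC_dual :=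
  MkLUC_dual (@act_scalar t mu) (@act_continuous t mu).

Definition GLUC_set : set LUC_dual := closure (range point_eval).

Lemma dual_eq (mu nu : LUC_dual) : mu =1 nu -> mu = nu.
Proof.
case: mu nu => [m ms mc] [n ns nc] /= /funext mn.
by subst n; congr MkLUC_dual; exact: Prop_irrelevance.
Qed.

Lemma dual_eval_continuous (f : LUC) : continuous (fun mu : LUC_dual => mu f : C).
Proof.
move=> mu; apply: (@continuous_comp _ {ptws LUC -> C} C dual_fun (fun k => k f)).
  exact: (@initial_continuous _ {ptws LUC -> C} dual_fun).
exact: (@proj_continuous _ (fun=> C) f).
Qed.

Lemma dual_act_continuous t : continuous (dual_act t).
Proof.
apply: (@continuous_comp_initial _ _ {ptws LUC -> C} dual_fun) => mu.
have FF : Filter ((dual_fun \o dual_act t) @ mu).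
  by apply: fmap_filter; exact: nbhs_filter.
apply/(@pointwise_cvgP LUC C _ _ FF) => f.
exact: (@dual_eval_continuous (luc_translate f t) mu).
Qed.

Lemma dual_act_GLUC t (mu : LUC_dual) :
  GLUC_set mu -> GLUC_set (dual_act t mu).
Proof.
move=> cmu B /dual_act_continuous /cmu [_ [[s _ <-] Bs]].
exists (dual_act t (point_eval s)); split => //; exists (t * s)%g => //.
exact: dual_eq.
Qed.

Definition GLUC := set_type GLUC_set.

Definition GLUC_act t (mu : GLUC) : GLUC :=
  SigSub (mem_set (dual_act_GLUC (t := t) (set_valP mu))).

End LUC.

Arguments LUC R G : clear implicits.
Arguments LUC_dual R G : clear implicits.
Arguments GLUC R G : clear implicits.

Section Flows.
Context {G : topologicalGroupType}.

Definition t_free (t : G) (X : Type) (act : G -> X -> X) :=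
  forall x, act t x <> x.

Definition free_action (X : Type) (act : G -> X -> X) :=
  forall (t : G) (x : X), act t x = x -> t = 1%g.

Record compact_flow := CompactFlow {
  flow_space :> topologicalType ;
  flow_act : G -> flow_space -> flow_space ;
  flow_compact : compact [set: flow_space] ;
  flow_hausdorff : hausdorff_space flow_space ;
  flow_act1 : forall x, flow_act 1%g x = x ;
  flow_actM : forall s t x, flow_act (s * t)%g x = flow_act s (flow_act t x) ;
  flow_act_continuous :
    continuous (fun p : G * flow_space => flow_act p.1 p.2) }.

Record compact_ambit := CompactAmbit {
  ambit_flow :> compact_flow ;
  ambit_base : ambit_flow ;
  ambit_dense : dense [set flow_act t ambit_base | t in [set: G]] }.

Definition is_factor_map (X Y : compact_flow) (phi : X -> Y) :=
  [/\ continuous phi, range phi = [set: Y] &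
      forall (t : G) (x : X), phi (flow_act t x) = flow_act t (phi x)].

Definition flow_factor (Y X : compact_flow) :=
  exists phi : X -> Y, is_factor_map phi.

Definition ambit_factor (Y X : compact_ambit) :=
  exists2 phi : X -> Y, is_factor_map phi & phi (ambit_base X) = ambit_base Y.

Definition universal_ambit (X : compact_ambit) :=
  forall Y : compact_ambit, ambit_factor Y X.

(* the empty flow is not minimal *)
Definition minimal_flow (X : compact_flow) :=
  [set: X] !=set0 /\
  forall A : set X, closed A -> A !=set0 ->
    (forall t x, A x -> A (flow_act t x)) -> A = [set: X].

Definition universal_minimal_flow (X : compact_flow) :=
  minimal_flow X /\ forall Y, minimal_flow Y -> flow_factor Y X.

End Flows.

Arguments compact_flow G : clear implicits.
Arguments compact_ambit G : clear implicits.

(* Main.v *)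
From HB Require Import structures.
Require Import Defs.
From mathcomp Require Import all_boot all_order all_algebra.
From mathcomp Require Import complex.
From mathcomp Require Import all_classical all_reals all_analysis.

(** Fix t and V as in the quasi-total boundedness condition. To see that t
    moves every point of GLUC it is enough to have finitely many LUC functions
    such that every x in G satisfies f x = 0 and f (t x) = 1 for one of them
    ([ex_displacing_luc]): a functional mu in GLUC is approximated at finitely
    many functions at once by an evaluation, so mu f and mu (f t) cannot agree
    for all of these f ([t_free_GLUC]).

    To construct the functions, choose a maximal set D such that the translates
    V g, for g in D, are pairwise disjoint; maximality makes the sets V^2 g
    cover G. Join g and h in D by an edge when V^3 h meets t V^3 g, or the other
    way around. The hypothesis that t V^3 and V^3 are disjoint says that there
    are no loops, and the finite cover bounds the degrees, because a translate
    V k contains at most one point of D. Hence D is a finite union of sets I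
    without edges ([bounded_degree_colouring]). For each of them a Urysohn
    function for the right uniformity is 0 on V^2 I and 1 off V^3 I
    ([luc_separation]). If x lies in V^2 g with g in I, then t x cannot lie in
    V^3 I, because that would be an edge inside I.

    For the consequences, GLUC is a compact ambit: compactness is the
    Banach-Alaoglu argument, with a limit along an ultrafilter computed at each
    function separately ([GLUC_compact]), and the action is jointly continuous
    because translation of an LUC function is continuous for the supremum norm
    ([GLUC_act_continuous]). Freeness pulls back along equivariant maps
    ([free_equivariant]). A universal ambit maps onto GLUC, and a universal
    minimal flow maps onto a minimal subflow of GLUC, which Zorn's lemma
    provides ([ex_minimal_flow]). *)

Set Implicit Arguments.
Unset Strict Implicit.
Unset Printing Implicit Defensive.

Import Order.TTheory GRing.Theory Num.Theory numFieldNormedType.Exports.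
Local Open Scope classical_set_scope.
Local Open Scope ring_scope.
Local Open Scope complex_scope.

(** * Colouring infinite graphs of bounded degree *)

Section Colouring.
Context {T : choiceType} (E : T -> T -> Prop).

Definition independent (I : set T) := forall x y, I x -> I y -> ~ E x y.

Lemma ex_maximal_independent (D : set T) :
  exists I, [/\ I `<=` D, independent I &
    forall x, D x -> independent (x |` I) -> I x].
Proof.
have [F|I [[ID Iind] Imax]] :=
  @Zorn_bigcup T [set I | I `<=` D /\ independent I].
  move=> FP totF; split; first by apply: bigcup_sub => X /FP [].
  move=> x y [X FX Xx] [Y FY Yy].
  have [XY|YX] := totF _ _ FX FY.
    exact: (FP _ FY).2 _ _ (XY _ Xx) Yy.
  exact: (FP _ FX).2 _ _ Xx (YX _ Yy).
exists I; split => // x Dx xI; apply: contrapT => nIx.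
apply: (Imax (x |` I)).
  by split; [move=> y; right|move=> /(_ x) H; apply: nIx; apply: H; left].
by split => // y [->|/ID].
Qed.

(** Removing a maximal independent set lowers all degrees by one: every vertex
    left over has a neighbour in that set, by maximality. The degree at x is
    bounded by bounding the duplicate-free lists of neighbours of x. *)
Lemma bounded_degree_colouring n (D : set T) :
  (forall x, ~ E x x) -> (forall x y, E x y -> E y x) ->
  (forall x s, D x -> uniq s -> (forall y, y \in s -> D y /\ E x y) ->
     (size s <= n)%N) ->
  exists2 S : seq (set T), (forall I, I \in S -> I `<=` D /\ independent I) &
    forall x, D x -> exists2 I, I \in S & I x.
Proof.
move=> Eirr Esym; elim: n D => [|n IH] D degD.
  exists [:: D] => [I|x Dx]; last by exists D; rewrite ?inE.
  rewrite inE => /eqP ->; split => // x y Dx Dy Exy.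
  have := degD x [:: y] Dx isT; rewrite ltnNge /= => H.
  by suff: false by []; apply: H => z; rewrite inE => /eqP ->.
have [I [ID Iind Imax]] := ex_maximal_independent D.
have [|S SP Scov] := IH (D `\` I).
  move=> x s [Dx nIx] us sP.
  have [y [Iy Exy]] : exists y, I y /\ E x y.
    apply: contrapT => H; apply/nIx/Imax => //.
    move=> y z [->|Iy] [->|Iz] //; last exact: Iind.
      by move=> Exz; apply: H; exists z.
    by move=> /Esym Exy; apply: H; exists y.
  apply: (degD x (y :: s) Dx) => [|z].
    by rewrite /= us andbT; apply/negP => /sP [[]].
  by rewrite inE => /predU1P[->|/sP[[]//]]; split=> //; exact: ID.
exists (I :: S) => [J|x Dx].
  by rewrite inE => /predU1P[->//|/SP[JD Jind]]; split => // x /JD[].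
have [Ix|nIx] := pselect (I x); first by exists I; rewrite ?mem_head.
by have [//|J JS Jx] := Scov x; exists J; rewrite // inE JS orbT.
Qed.

End Colouring.

(** * The right uniformity of a topological group *)

Section RightUniformity.
Context {G : topologicalGroupType}.
Implicit Types U V : set G.

Lemma nbhs1_mul U : nbhs (1%g : G) U ->
  exists2 V, nbhs (1%g : G) V & mul_set V V `<=` U.
Proof.
move=> U1.
have : nbhs ((1, 1)%g : G * G) ((fun x : G * G => (x.1 * x.2)%g) @^-1` U).
  by apply: mulg_continuous; rewrite /= mulg1.
move=> [[P Q] [/= P1 Q1] PQ]; exists (P `&` Q); first exact: filterI.
by move=> _ [a [Pa _] [b [_ Qb] <-]]; apply: (PQ (a, b)).
Qed.

Lemma nbhs1_inv U : nbhs (1%g : G) U -> nbhs (1%g : G) (inv_set U).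
Proof.
move=> U1; have : nbhs (1%g : G) ((fun x : G => x^-1%g) @^-1` U).
  by apply: invg_continuous; rewrite /= invg1.
by apply: filterS => x Ux; exists x^-1%g; rewrite ?invgK.
Qed.

Lemma nbhs_rtrans U x : nbhs (1%g : G) U -> nbhs x [set y | U (y * x^-1)%g].
Proof.
move=> U1.
apply: (@continuous_comp _ _ _ (fun y => (y, x^-1%g))
  (fun p : G * G => (p.1 * p.2)%g) x).
- by apply: cvg_pair => /=; [exact: cvg_id|exact: cvg_cst].
- exact: mulg_continuous.
- by rewrite /= mulgV.
Qed.

(** A copy of G without the topology of G, so that it can carry the right
    uniformity as its own structure; x and y are close when y x^-1 is near the
    identity. *)
Definition right_uniform : Type := G.

HB.instance Definition _ := Choice.on right_uniform.

Definition right_entourage : set_system (right_uniform * right_uniform) :=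
  filter_from (nbhs (1%g : G))
    (fun U => [set xy | U (xy.2 * (xy.1 : G)^-1)%g]).

Lemma right_entourage_filter : Filter right_entourage.
Proof.
apply: filter_from_filter; first by exists setT; exact: filterT.
by move=> U V U1 V1; exists (U `&` V); first exact: filterI.
Qed.

Lemma right_entourage_diagonal A :
  right_entourage A -> (diagonal `<=` A)%classic.
Proof.
move=> [U U1 UA] [x y] /diagonalP <-; apply: UA => /=.
by rewrite mulgV; exact: nbhs_singleton.
Qed.

Lemma right_entourage_inv A :
  right_entourage A -> right_entourage (A^-1)%relation.
Proof.
move=> [U U1 UA]; exists (inv_set U); first exact: nbhs1_inv.
move=> [x y] /= [u Uu uE]; apply: UA => /=.
by rewrite -[(x * _)%g]invgK invgM invgK -uE invgK.
Qed.

Lemma right_entourage_split A : right_entourage A ->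
  exists2 B, right_entourage B & (B \; B `<=` A)%relation.
Proof.
move=> [U U1 UA]; have [V V1 VU] := nbhs1_mul U1.
exists [set xy | V (xy.2 * (xy.1 : G)^-1)%g]; first by exists V.
move=> [x z] [y /= Vyx Vzy]; apply/UA/VU => /=.
exists (z * (y : G)^-1)%g => //.
by exists (y * (x : G)^-1)%g => //; rewrite mulgA mulgVK.
Qed.

HB.instance Definition _ := @isUniform.Build right_uniform right_entourage
  right_entourage_filter right_entourage_diagonal right_entourage_inv
  right_entourage_split.

End RightUniformity.

Arguments right_uniform G : clear implicits.

(** * Uniformly continuous Urysohn functions *)

(** The distance to A, truncated at r. It is the infimum of the radii d such
    that x lies in a d-ball around A; letting all d >= r compete caps the value
    and makes the infimum meaningful for empty A. *)
Lemma capped_distance (R : realType) (M : pseudoMetricType R) (A : set M)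
    (r : R) : 0 < r ->
  exists f : M -> R,
    [/\ forall x, 0 <= f x <= r, forall x, A x -> f x = 0,
        forall x, (forall a, A a -> ~ ball a r x) -> f x = r &
        forall x y d, 0 < d -> ball x d y -> f y <= f x + d].
Proof.
move=> r0; pose S x :=
  [set d : R | r <= d \/ 0 < d /\ exists2 a, A a & ball a d x].
have S0 x : lbound (S x) 0.
  by move=> d [/(lt_le_trans r0)/ltW//|[/ltW]].
have Sr x : S x r by left.
have infS x d : S x d -> inf (S x) <= d.
  by apply: ge_inf; exists 0.
have Sinf x d : lbound (S x) d -> d <= inf (S x).
  by apply: lb_le_inf; exists r.
exists (fun x => inf (S x)); split.
- by move=> x; rewrite Sinf//= infS.
- move=> x Ax; apply/eqP; rewrite eq_le Sinf// andbT.
  apply/ler_addgt0Pl => e e0; rewrite addr0; apply: infS; right; split=> //.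
  by exists x => //; exact: ballxx.
- move=> x far; apply/eqP; rewrite eq_le infS//= Sinf// => d [//|[d0 [a Aa]]].
  by rewrite leNgt => adx; apply/negP => /ltW dr; exact/(far a Aa)/(le_ball dr).
- move=> x y d d0 xdy.
  rewrite -lerBlDr; apply: Sinf => e Sxe; rewrite lerBlDr; apply: infS.
  case: Sxe => [re|[e0 [a Aa aex]]].
    by left; rewrite (le_trans re)// lerDl ltW.
  by right; split; [exact: addr_gt0|exists a => //; exact: ball_triangle xdy].
Qed.

(** The gauge of the entourage E is a pseudometric, coarser than the given
    uniformity, in which some ball relation is finer than E; the capped
    distance to A for it has the required modulus of continuity. *)
Lemma uniform_urysohn (R : realType) (T : uniformType) (E : set (T * T))
    (A : set T) : entourage E ->
  exists f : T -> R,
    [/\ forall x, 0 <= f x <= 1, forall x, A x -> f x = 0,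
        forall x, (forall a, A a -> ~ E (a, x)) -> f x = 1 &
        forall e, 0 < e -> entourage [set xy | `|f xy.1 - f xy.2| < e]].
Proof.
move=> entE; pose M : pseudoMetricType R := gauge.type entE.
have : @entourage M E by exists 0%N => // -[x y] [].
rewrite -entourage_ballE => -[r /= r0 rE].
have [f [f01 fA ffar fball]] := @capped_distance R M A r r0.
have ri0 : 0 < r^-1 by rewrite invr_gt0.
exists (fun x => f x / r); split.
- by move=> x; rewrite ler_pdivlMr// mul0r ler_pdivrMr// mul1r.
- by move=> x /fA ->; rewrite mul0r.
- move=> x far; rewrite ffar ?divff ?gt_eqF// => a Aa ax.
  by apply: (far a Aa); exact: (rE (a, x)).
- move=> e e0; apply: (gauge.gauge_ent entE).
  suff : @entourage M [set xy | `|f xy.1 / r - f xy.2 / r| < e] by [].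
  have d0 : 0 < e * r / 2 by rewrite divr_gt0 ?mulr_gt0.
  rewrite -entourage_ballE; exists (e * r / 2) => //= -[x y] /= xy.
  rewrite -mulrBl normrM (gtr0_norm ri0) ltr_pdivrMr//.
  apply: (@le_lt_trans _ _ (e * r / 2)).
    rewrite ler_norml lerBlDl (fball _ _ _ d0 (ball_sym xy)) andbT.
    by rewrite lerNl opprB lerBlDl; exact: fball.
  by rewrite ltr_pdivrMr// ltr_pMr ?mulr_gt0// ltr1n.
Qed.

(** * Construction of LUC functions *)

Section Separation.
Context {R : realType} {G : topologicalGroupType}.
Local Notation C := (R[i]^o).

Lemma normc_real (a : R) : `|a%:C| = `|a|%:C :> R[i].
Proof. by rewrite normc_def /= expr0n /= addr0 sqrtr_sqr. Qed.

Lemma gt0_complex_real (e : R[i]) : 0 < e -> exists2 d : R, 0 < d & e = d%:C.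
Proof.
move=> e0; have eE := RRe_real (gtr0_real e0).
by exists (complex.Re e); rewrite // -ltcR eE.
Qed.

(** Small left translations u x = (u t^-1) (t x) move the argument by an element
    near the identity on the left, uniformly in x. *)
Lemma is_luc_of_modulus (f : G -> C) (M : R[i]) :
  (forall x, `|f x| <= M) ->
  (forall e : R[i], 0 < e -> exists2 U, nbhs (1%g : G) U &
     forall u x, U u -> `|f x - f (u * x)%g| < e) ->
  is_luc f.
Proof.
move=> fM fmod; split; first by exists M.
- move=> x; apply/(@cvgrPdist_lt _ C G (nbhs x) (nbhs_filter x)) => e e0.
  have [U U1 fU] := fmod e e0.
  apply: filterS (nbhs_rtrans x U1) => y /= /(fU _ x).
  by rewrite mulgVK.
- move=> t; apply/uniform_cvgP => e e0; have [U U1 fU] := fmod e e0.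
  apply: filterS (nbhs_rtrans t U1) => u /= Uu x.
  by have := fU _ (t * x)%g Uu; rewrite /ltranslate mulgA mulgVK.
Qed.

Lemma luc_separation (A U : set G) : nbhs (1%g : G) U ->
  exists f : LUC R G, (forall x, A x -> f x = 0) /\
    (forall x, ~ mul_set U A x -> f x = 1).
Proof.
move=> U1; pose E : set (right_uniform G * right_uniform G) :=
  [set xy | U (xy.2 * (xy.1 : G)^-1)%g].
have entE : entourage E by exists U.
have [f [f01 fA ffar fmod]] := @uniform_urysohn R (right_uniform G) E A entE.
have fluc : is_luc (fun x : G => (f x)%:C : C).
  apply: (@is_luc_of_modulus _ 1) => [x|e /gt0_complex_real[d d0 ->]].
    have /andP[f0 f1] := f01 x.
    by rewrite normc_real ger0_norm// lecR.
  have [W W1 WE] := fmod d d0; exists W => // u x Wu.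
  rewrite -raddfB normc_real ltcR.
  by apply: (WE (x, (u * x)%g)); rewrite /= mulgK.
have fin : (fun x : G => (f x)%:C : C) \in luc_pred by rewrite inE.
exists (MkLUC fin); split=> x /= => [/fA -> //|far].
rewrite ffar // => a Aa /= Ua; apply: far.
by exists (x * a^-1)%g => //; exists a => //; rewrite mulgVK.
Qed.

End Separation.

(** * Functions displaced by t *)

Section DisjointTranslates.
Context {G : topologicalGroupType}.
Implicit Types V : set G.

(** A maximal family of disjoint translates V g; the first conclusion is
    disjointness, read through the symmetry of V: no V k contains two points of
    D. If V x meets V g then x lies in V^2 g, so maximality gives the cover. *)
Lemma ex_disjoint_translates V : nbhs (1%g : G) V -> inv_set V = V ->
  exists D : set G,
    (forall k g h, D g -> D h -> rtrans V k g -> rtrans V k h -> g = h) /\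
    (forall x, exists2 g, D g & rtrans (mul_set V V) g x).
Proof.
move=> V1 Vinv.
have VV a : V a -> V a^-1%g by move=> Va; rewrite -Vinv; exists a.
have [D [_ Dtriv Dmax]] :=
  ex_maximal_disjoint_subcollection (rtrans V) [set: G].
exists D; split=> [k g h Dg Dh [a Va ag] [b Vb bh]|x].
  apply: (Dtriv g h Dg Dh); exists k; split.
    by exists a^-1%g; [exact: VV|rewrite -ag mulKg].
  by exists b^-1%g; [exact: VV|rewrite -bh mulKg].
apply: contrapT => nx.
have Dx : ~ D x.
  move=> Dx; apply: nx; exists x => //; exists 1%g; rewrite ?mul1g//.
  exists 1%g; first exact: nbhs_singleton.
  by exists 1%g; rewrite ?mul1g//; exact: nbhs_singleton.
have disj g : D g -> rtrans V x `&` rtrans V g !=set0 -> False.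
  move=> Dg [_ [[a Va <-] [b Vb abE]]]; apply: nx; exists g => //.
  exists (a^-1 * b)%g; last by rewrite -mulgA abE mulKg.
  by exists a^-1%g; [exact: VV|exists b].
apply: (Dmax (x |` D)) => //.
  by split; [move=> y; right|move=> /(_ x) H; apply: Dx; apply: H; left].
move=> g h [->|Dg] [->|Dh] // ne.
- by case: (disj h).
- by case: (disj g) => //; rewrite setIC.
- exact: (Dtriv g h).
Qed.

End DisjointTranslates.

Section Displacement.
Context {R : realType} {G : topologicalGroupType}.
Context (t : G) (V : set G).
Context (Vsym : symmetric_nbhs V) (Vqtb : qtb_at t V).

Lemma symmetric_nbhsV a : V a -> V a^-1%g.
Proof. by move=> Va; rewrite -Vsym.2; exists a. Qed.

Lemma cubeV a : cube V a -> cube V a^-1%g.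
Proof.
move=> [_ [x Vx [y Vy <-]] [z Vz <-]]; exists (z^-1 * y^-1)%g.
  exists z^-1%g; first exact: symmetric_nbhsV.
  by exists y^-1%g => //; exact: symmetric_nbhsV.
by exists x^-1%g; [exact: symmetric_nbhsV|rewrite !invgM !mulgA].
Qed.

Definition shifts_onto (g h : G) :=
  exists c d, [/\ cube V c, cube V d & (c * h = t * (d * g))%g].

Definition adjacent g h := shifts_onto g h \/ shifts_onto h g.

Lemma adjacent_sym g h : adjacent g h -> adjacent h g.
Proof. by case; [right|left]. Qed.

(** A loop at g would be an equation c = t d between elements of V^3. *)
Lemma adjacent_irr g : ~ adjacent g g.
Proof.
suff nshift : ~ shifts_onto g g by case.
move=> [c [d [Vc Vd]]]; rewrite mulgA => /mulIg cE.
have : (ltrans t (cube V) `&` cube V) c by split => //; exists d.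
by rewrite Vqtb.1.
Qed.

(** An edge c h = t d g gives h = (c^-1 t d t^-1) t g, where the bracket lies in
    V^3 t V^3 t^-1; an edge in the other direction uses the second set of the
    quasi-total boundedness condition. Thus the neighbours of g are covered by
    translates of V, whose number does not depend on g. *)
Lemma adjacent_cover : exists K : G -> seq G, exists n,
  (forall g, size (K g) = n) /\
  forall g h, adjacent g h -> exists2 k, k \in K g & rtrans V k h.
Proof.
have [_ [_ /finite_seqP[s ->] Vs]] := Vqtb.
exists (fun g => [seq k * (t * g) | k <- s]%g ++
  [seq k * (t^-1 * g) | k <- s]%g).
exists (size s + size s)%N; split=> [g|g h].
  by rewrite size_cat !size_map.
case=> -[c [d [Vc Vd cdE]]].
- have [|k /= ks [v Vv vk]] := Vs (c^-1 * t * d * t^-1)%g.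
    left; exists (c^-1 * t * d)%g => //; exists (c^-1 * t)%g; last by exists d.
    by exists c^-1%g => //; exact: cubeV.
  exists (k * (t * g))%g.
    by rewrite mem_cat; apply/orP; left; apply/mapP; exists k.
  exists v => //; rewrite mulgA vk !mulgA mulgVK -!mulgA.
  by rewrite -cdE mulKg.
- have [|k /= ks [v Vv vk]] := Vs (d^-1 * t^-1 * c * t)%g.
    right; exists (d^-1 * t^-1 * c)%g => //; exists (d^-1 * t^-1)%g;
      last by exists c.
    by exists d^-1%g => //; exact: cubeV.
  exists (k * (t^-1 * g))%g.
    by rewrite mem_cat; apply/orP; right; apply/mapP; exists k.
  exists v => //; rewrite mulgA vk !mulgA mulgK -!mulgA.
  by rewrite cdE mulKg mulKg.
Qed.

Lemma ex_displacing_luc : exists S : seq (LUC R G),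
  forall x, exists2 f, f \in S & f x = 0 /\ f (t * x)%g = 1.
Proof.
have [D [Ddisj Dcov]] := ex_disjoint_translates Vsym.1 Vsym.2.
have [K [n [Kn Kadj]]] := adjacent_cover.
have [|S Sind Scov] := @bounded_degree_colouring G adjacent n D
    adjacent_irr adjacent_sym.
  move=> g s Dg us sP.
  have /choice[k kP] : forall h, exists k, h \in s -> k \in K g /\ rtrans V k h.
    move=> h; case: (boolP (h \in s)) => [/sP[_ /Kadj[k ? ?]]|_].
      by exists k.
    by exists 1%g.
  (* k sends a neighbour to a translate covering it; it is injective since a
     translate of V contains at most one point of D *)
  rewrite -(Kn g) -(size_map k); apply: uniq_leq_size.
    rewrite map_inj_in_uniq// => x y xs ys kxy.
    apply: (Ddisj (k x)); [exact: (sP _ xs).1|exact: (sP _ ys).1| |].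
      exact: (kP _ xs).2.
    by rewrite kxy; exact: (kP _ ys).2.
  by move=> _ /mapP[h hs ->]; exact: (kP _ hs).1.
(* f I vanishes on V^2 I and equals 1 off V^3 I *)
have /choice[f fP] : forall I : set G, exists f : LUC R G,
    (forall x, mul_set (mul_set V V) I x -> f x = 0) /\
    (forall x, ~ mul_set V (mul_set (mul_set V V) I) x -> f x = 1).
  by move=> I; exact: @luc_separation R G _ V Vsym.1.
exists (map f S) => x.
have [g Dg [w VVw xE]] := Dcov x.
have [I IS Ig] := Scov g Dg.
exists (f I); first exact: map_f.
split; first by apply: (fP I).1; exists w => //; exists g.
(* t x in V^3 I would make g adjacent to a point of I *)
apply: (fP I).2 => -[v Vv [_ [w' [a Va [b Vb <-]] [h Ih <-]] txE]].
apply: ((Sind I IS).2 g h Ig Ih); left; exists (v * (a * b))%g, w; split.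
- by exists (v * a)%g; [exists v => //; exists a|exists b; rewrite ?mulgA].
- by exists w => //; exists 1%g; rewrite ?mulg1//; exact: nbhs_singleton Vsym.1.
- by rewrite xE -txE !mulgA.
Qed.

End Displacement.

(** * Subspaces and ultrafilters *)

Lemma compact_set_type (X : topologicalType) (A : set X) :
  compact A -> compact [set: set_type A].
Proof.
move=> cA F FF _.
have FA : F (set_val @^-1` A).
  by apply: filterS filterT => x _; exact: set_valP.
have [p [Ap clp]] := cA _ (fmap_proper_filter set_val FF) FA.
exists (SigSub (mem_set Ap)); split => // P Q FP.
rewrite nbhsE => -[B [[W oW <-] Wp] BQ].
have FP' : (set_val @ F) (set_val @` P).
  by apply: (@filterS _ F _ P _ _ FP) => x Px; exists x.
have [_ [[x Px <-] Wx]] := clp _ _ FP' (open_nbhs_nbhs (conj oW Wp)).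
by exists x; split => //; exact: BQ.
Qed.

Lemma hausdorff_inj (X Y : topologicalType) (f : X -> Y) :
  continuous f -> injective f -> hausdorff_space Y -> hausdorff_space X.
Proof.
move=> cf injf hY p q clpq; apply/injf/hY => P Q Pp Qq.
have [x [Px Qx]] := clpq _ _ (cf _ _ Pp) (cf _ _ Qq).
by exists (f x).
Qed.

Lemma set_val_continuous (X : topologicalType) (A : set X) :
  continuous (set_val : set_type A -> X).
Proof. exact: initial_continuous. Qed.

Lemma hausdorff_set_type (X : topologicalType) (A : set X) :
  hausdorff_space X -> hausdorff_space (set_type A).
Proof.
apply: (@hausdorff_inj _ _ set_val); last exact: val_inj.
exact: set_val_continuous.
Qed.

(** The image h @ F decides every subset of T, so it converges to each of its
    cluster points, and K contains one. *)
Lemma ultra_compact_cvg (S : Type) (T : topologicalType) (F : set_system S)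
    (h : S -> T) (K : set T) :
  UltraFilter F -> compact K -> F (h @^-1` K) -> exists p : T, h @ F --> p.
Proof.
move=> FU cK FK; have FF : ProperFilter F by exact: ultra_proper.
have [p [_ clp]] := cK _ (fmap_proper_filter h FF) FK.
exists p => U Up; have [//|FnU] := in_ultra_setVsetC (h @^-1` U) FU.
by have [y [/= nUy Uy]] := clp (~` U) U FnU Up.
Qed.

(** * Compactness of GLUC *)

Section ComplexDisc.
Context {R : realType}.
Local Notation C := (R[i]^o).

(** The disc of radius M lies in the square with half side M, an image of a
    product of two real segments. *)
Lemma bounded_complex_subcompact (M : R[i]) :
  exists2 K : set C, compact K & forall z : C, `|z| <= M -> K z.
Proof.
pose m := complex.Re M.
have cont (w : C) : continuous (fun a : R => w * a%:C : C).
  move=> a; apply/(@cvgrPdist_lt _ C R (nbhs a) (nbhs_filter a)) => e e0.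
  have w0 : 0 < `|w| + 1 by rewrite ltr_wpDl.
  have [d d0 dE] : exists2 d : R, 0 < d & e / (`|w| + 1) = d%:C.
    by apply: gt0_complex_real; rewrite divr_gt0.
  apply: filterS (nbhsx_ballx a d d0) => b /= ab.
  rewrite -mulrBr -raddfB normrM normc_real.
  rewrite -(divfK (lt0r_neq0 w0) e) dE mulrC.
  rewrite (@le_lt_trans _ _ (`|a - b|%:C * (`|w| + 1)))//.
    by rewrite ler_wpM2l// ?ler0c// lerDl.
  by rewrite ltr_pM2r// ltcR.
pose I := `[- m, m]%classic : set R.
(* the factor 1 lets [cont] serve both coordinates *)
exists [set (1 * p.1%:C : C) + ('i%C * p.2%:C : C) | p in I `*` I].
  apply: continuous_compact; last first.
    by apply: compact_setX; exact: segment_compact.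
  apply: continuous_subspaceT => p; apply: (@cvgD _ C).
    apply: (@continuous_comp _ _ C fst (fun a : R => 1 * a%:C));
      last exact: cont.
    exact: cvg_fst.
  apply: (@continuous_comp _ _ C snd (fun a : R => 'i%C * a%:C));
    last exact: cont.
  exact: cvg_snd.
move=> z zM; exists (complex.Re z, complex.Im z);
  last by rewrite mul1r [RHS]complexE.
have M0 : 0 <= M by rewrite (le_trans _ zM).
have zm : `|z| <= m%:C by rewrite /m (RRe_real (ger0_real M0)).
move: zm; rewrite normc_def lecR => zm.
have bnd (a b : R) : Num.sqrt (a ^+ 2 + b ^+ 2) <= m -> a \in `[- m, m].
  move=> abm; rewrite in_itv /= -ler_norml (le_trans _ abm)// -sqrtr_sqr.
  by rewrite ler_sqrt ?addr_ge0 ?sqr_ge0// lerDl sqr_ge0.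
by split; rewrite /I /=; [exact: bnd zm|apply: bnd; rewrite addrC; exact: zm].
Qed.

End ComplexDisc.

Section GLUCFlow.
Context {R : realType} {G : topologicalGroupType}.
Local Notation C := (R[i]^o).
Implicit Types (f g : LUC R G) (mu : LUC_dual R G).

Lemma dual_cvg (F : set_system (LUC_dual R G)) mu : Filter F ->
  (forall f, (fun nu : LUC_dual R G => nu f : C) @ F --> (mu f : C)) ->
  F --> mu.
Proof.
move=> FF Fmu.
have H : (dual_fun : LUC_dual R G -> {ptws LUC R G -> C}) @ F -->
    (dual_fun mu : {ptws LUC R G -> C}).
  apply/(@pointwise_cvgP (LUC R G) C _ _ (fmap_filter _ FF)) => f; exact: Fmu.
move=> P; rewrite nbhsE => -[B [[W oW <-] Wp] BP].
have HW : F (dual_fun @^-1` W) := H W (open_nbhs_nbhs (conj oW Wp)).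
exact: filterS BP HW.
Qed.

Lemma nbhs_dual_close (S : seq (LUC R G)) mu (e : R[i]) : 0 < e ->
  nbhs mu [set nu : LUC_dual R G | forall f, f \in S -> `|mu f - nu f| < e].
Proof.
move=> e0; elim: S => [|f S IH]; first by apply: filterS filterT.
have := @dual_eval_continuous R G f mu.
move/(@cvgrPdist_lt _ C _ _ (nbhs_filter _)) => /(_ e e0) near_f.
apply: filterS (filterI near_f IH) => nu [/= fnu Snu] g.
by rewrite inE => /predU1P[->|/Snu].
Qed.

Lemma GLUC_approx (S : seq (LUC R G)) mu (e : R[i]) : GLUC_set mu -> 0 < e ->
  exists s : G, forall f, f \in S -> `|mu f - f s| < e.
Proof.
move=> muG e0; have [_ [[s _ <-] Ns]] := muG _ (nbhs_dual_close S mu e0).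
by exists s.
Qed.

(** Evaluations are 1-Lipschitz for the supremum norm, and this passes to their
    weak-star closure. *)
Lemma GLUC_dist mu f g (M : R[i]) : GLUC_set mu ->
  (forall x, `|f x - g x| <= M) -> `|mu f - mu g| <= M.
Proof.
move=> muG fgM; have M0 : 0 <= M by rewrite (le_trans _ (fgM 1%g)).
have rD : `|mu f - mu g| - M \is Num.real.
  by rewrite realB ?normr_real// ger0_real.
rewrite -subr_le0 real_leNgt ?real0//; apply/negP => d0.
have [s Hs] := GLUC_approx [:: f; g] muG (divr_gt0 d0 (ltr0n _ 2)).
have := Hs f; rewrite mem_head => /(_ isT) fs.
have := Hs g; rewrite !inE eqxx orbT => /(_ isT) gs.
have : `|mu f - mu g| < `|mu f - mu g| - M + M.
  rewrite {1}(_ : mu f - mu g = (mu f - f s) + (f s - g s) + (g s - mu g));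
    last first.
    by rewrite !addrA !subrK.
  rewrite (le_lt_trans (ler_normD _ _))//.
  rewrite (le_lt_trans (lerD (ler_normD _ _) (lexx _)))//.
  rewrite addrAC ltr_leD// [ltRHS]splitr ltrD// distrC//.
by rewrite subrK ltxx.
Qed.

Lemma GLUC_norm mu f (M : R[i]) : GLUC_set mu ->
  (forall x, `|f x| <= M) -> `|mu f| <= M.
Proof.
move=> muG fM.
have mu0 : mu 0 = 0.
  have := dual_scalar mu (-1) 0 0.
  by rewrite scaler0 addr0 mulN1r addNr.
have := @GLUC_dist mu f 0 M muG; rewrite mu0 subr0; apply=> x.
by rewrite [X in _ - X](_ : _ = 0) // subr0.
Qed.

(** Along an ultrafilter on GLUC, the values at each f are bounded, hence
    converge; the pointwise limit m is linear, and continuous because the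
    functionals in GLUC are uniformly 1-Lipschitz. *)
Lemma GLUC_compact : compact (GLUC_set : set (LUC_dual R G)).
Proof.
rewrite compact_ultra => F FU FG.
have FF : ProperFilter F by exact: ultra_proper.
have /choice[m mP] : forall f : LUC R G, exists z : C,
    (fun nu : LUC_dual R G => nu f : C) @ F --> z.
  move=> f; have [[M fM] _ _] := lucP f.
  have [K cK KM] := @bounded_complex_subcompact R M.
  apply: ultra_compact_cvg cK _; apply: filterS FG => nu nuG.
  by apply: KM; exact: GLUC_norm nuG fM.
have ms : scalar m.
  move=> a f g; apply: (@cvg_unique C (@norm_hausdorff _ C) _
    (fmap_proper_filter _ FF) _ _ (mP _)).
  rewrite (_ : (fun nu : LUC_dual R G => nu (a *: f + g) : C) =
               (fun nu => a * nu f + nu g : C)); last first.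
    by apply/funext => nu; rewrite dual_scalar.
  apply: (@cvgD _ C); last exact: mP.
  by apply: (@cvgZr _ C); exact: mP.
have mc : continuous m.
  move=> f; apply/(@cvgrPdist_lt _ C _ _ (nbhs_filter f)) => e e0.
  have e20 : 0 < e / 2 by rewrite divr_gt0.
  have /(@luc_cvgP R G _ id f) H : id @ f --> id f by exact: cvg_id.
  apply: (@filterS _ _ (nbhs_filter f) _ _ _ (H _ e20)) => g fg.
  have e40 : 0 < e / 2 / 2 by rewrite divr_gt0.
  (* compare m f and m g through one nu in GLUC close to m at f and at g *)
  have near_m h := (@cvgrPdist_lt _ C _ _ FF _ _).1 (mP h) _ e40.
  have [nu [[nuG mf] mg]] :=
    filter_ex (filterI (filterI FG (near_m f)) (near_m g)).
  have nufg : `|nu f - nu g| <= e / 2 by apply: GLUC_dist => // x; exact: ltW.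
  rewrite (_ : m f - m g = (m f - nu f) + (nu f - nu g) + (nu g - m g));
    last first.
    by rewrite !addrA !subrK.
  rewrite addrAC (le_lt_trans (ler_normD _ _))// [ltRHS]splitr ltr_leD//.
  by rewrite (le_lt_trans (ler_normD _ _))// [ltRHS]splitr ltrD// distrC.
pose mu := MkLUC_dual ms mc.
have Fmu : F --> mu by exact: dual_cvg.
exists mu; split => //; apply: (@closed_closure _ (range (@point_eval R G))).
move=> B Bmu.
by apply: (@filter_ex _ F); apply: filterI => //; exact: Fmu.
Qed.

End GLUCFlow.

(** * The action on GLUC is t-free *)

Lemma t_free_GLUC (R : realType) (G : topologicalGroupType) (t : G)
    (V : set G) :
  symmetric_nbhs V -> qtb_at t V ->
  t_free t (GLUC_act : G -> GLUC R G -> GLUC R G).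
Proof.
move=> Vsym Vqtb mu /(congr1 \val) /= fixmu.
have fixf f : (\val mu : LUC_dual R G) (luc_translate f t) =
    (\val mu : LUC_dual R G) f := congr1 (fun nu : LUC_dual R G => nu f) fixmu.
have [S SP] := ex_displacing_luc (R := R) Vsym Vqtb.
have h0 : 0 < 1 / 2 :> R[i] by rewrite divr_gt0.
have [s Hs] := GLUC_approx (S ++ [seq luc_translate f t | f <- S])
  (set_valP mu) h0.
have [f fS [fs0 fts1]] := SP s.
have fs : `|(\val mu : LUC_dual R G) f| < 1 / 2.
  by have := Hs f; rewrite mem_cat fS fs0 subr0; exact.
have fts : `|(\val mu : LUC_dual R G) f - 1| < 1 / 2.
  have := Hs (luc_translate f t).
  rewrite fixf /= /ltranslate fts1; apply.
  by rewrite mem_cat; apply/orP; right; apply/mapP; exists f.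
have : `|1 : R[i]| < 1 / 2 + 1 / 2.
  rewrite -[X in `|X|](subrK ((\val mu : LUC_dual R G) f)).
  by rewrite (le_lt_trans (ler_normD _ _))// ltrD// distrC.
by rewrite -splitr normr1 ltxx.
Qed.

(** * GLUC as a compact ambit *)

Section GreatestAmbit.
Context {R : realType} {G : topologicalGroupType}.
Local Notation C := (R[i]^o).
Implicit Types (f g : LUC R G) (mu : LUC_dual R G).

Lemma dual_hausdorff : hausdorff_space (LUC_dual R G).
Proof.
move=> mu nu clmn; apply: dual_eq => f.
apply: (@norm_hausdorff _ C) => P Q Pmu Qnu.
have [k [Pk Qk]] := clmn _ _ (@dual_eval_continuous R G f mu _ Pmu)
  (@dual_eval_continuous R G f nu _ Qnu).
by exists (k f).
Qed.

(** Near (t, mu), the value nu (f u) is within e / 2 of nu (f t) because f u is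
    uniformly close to f t, and nu (f t) is close to mu (f t) by weak-star
    convergence. *)
Lemma GLUC_act_continuous :
  continuous (fun p : G * GLUC R G => GLUC_act p.1 p.2).
Proof.
apply: (@continuous_comp_initial _ _ (LUC_dual R G) set_val) => -[t mu].
apply: dual_cvg => f /=.
have muG : GLUC_set (\val mu : LUC_dual R G) by exact: set_valP.
apply/(@cvgrPdist_lt _ C _ _ (nbhs_filter (t, mu))) => e e0.
have e20 : 0 < e / 2 by rewrite divr_gt0.
have [_ _ lf] := lucP f.
have near_t : \forall p \near (t, mu),
    forall x, `|f (t * x)%g - f (p.1 * x)%g| < e / 2.
  have /uniform_cvgP/(_ _ e20) := lf t; exact: cvg_fst.
have near_mu : \forall p \near (t, mu),
    `|(\val mu : LUC_dual R G) (luc_translate f t) -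
      (\val p.2 : LUC_dual R G) (luc_translate f t)| < e / 2.
  have evc := @dual_eval_continuous R G (luc_translate f t) (\val mu).
  have H : nbhs mu [set nu : GLUC R G |
      `|(\val mu : LUC_dual R G) (luc_translate f t) -
      (\val nu : LUC_dual R G) (luc_translate f t)| < e / 2].
    have evc_near := (@cvgrPdist_lt _ C _ _ (nbhs_filter _) _ _).1 evc _ e20.
    exact: (@set_val_continuous (LUC_dual R G) GLUC_set mu _ evc_near).
  exact: (cvg_snd H).
apply: filterS (filterI near_t near_mu) => -[u nu] /= [ftu munu].
rewrite -(subrK ((\val nu : LUC_dual R G) (luc_translate f t))
  (_ (luc_translate f t))).
rewrite -addrA (le_lt_trans (ler_normD _ _))// [ltRHS]splitr ltr_leD//.
apply: GLUC_dist => [|x]; first exact: set_valP.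
exact: ltW (ftu x).
Qed.

Definition GLUC_flow : compact_flow G.
Proof.
refine (@CompactFlow G (GLUC R G) GLUC_act _ _ _ _ GLUC_act_continuous).
- by apply: compact_set_type; exact: GLUC_compact.
- by apply: hausdorff_set_type; exact: dual_hausdorff.
- move=> mu; apply/val_inj/dual_eq => f /=; congr (_ _).
  by apply/val_inj/funext => x /=; rewrite /ltranslate mul1g.
- move=> s t mu; apply/val_inj/dual_eq => f /=; congr (_ _).
  by apply/val_inj/funext => x /=; rewrite /ltranslate mulgA.
Defined.

Lemma point_eval_GLUC (s : G) : GLUC_set (point_eval s : LUC_dual R G).
Proof. by apply: subset_closure; exists s. Qed.

Definition GLUC_base : GLUC_flow := SigSub (mem_set (@point_eval_GLUC 1%g)).

Lemma GLUC_dense : dense [set flow_act t GLUC_base | t in [set: G]].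
Proof.
move=> U [mu Umu] [W oW WU].
have Wmu : W (\val mu) by rewrite -WU in Umu.
have [_ [[s _ <-] Ws]] := set_valP mu W (open_nbhs_nbhs (conj oW Wmu)).
exists (flow_act s GLUC_base); split; last by exists s.
have sE : \val (flow_act s GLUC_base) = point_eval s :> LUC_dual R G.
  by apply: dual_eq => f /=; rewrite /ltranslate mulg1.
by rewrite -WU /preimage /= -[X in W X]/(\val (flow_act s GLUC_base)) sE.
Qed.

Definition GLUC_ambit : compact_ambit G := CompactAmbit GLUC_dense.

End GreatestAmbit.

(** * Minimal subflows *)

Section MinimalSubflow.
Context {G : topologicalGroupType} (X : compact_flow G).

Section Subflow.
Context (A : set X) (clA : closed A).
Context (invA : forall t x, A x -> A (flow_act t x)).

Definition subflow_act (t : G) (x : set_type A) : set_type A :=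
  SigSub (mem_set (invA t (set_valP x))).

Lemma subflow_act_continuous :
  continuous (fun p : G * set_type A => subflow_act p.1 p.2).
Proof.
apply: (@continuous_comp_initial _ _ X set_val) => -[t x].
apply: (@continuous_comp _ _ _ (fun p : G * set_type A => (p.1, set_val p.2))
  (fun p : G * X => flow_act p.1 p.2)).
  apply: cvg_pair => /=; first exact: cvg_fst.
  apply: (@cvg_comp _ _ _ snd set_val (nbhs (t, x)) (nbhs x)).
    exact: cvg_snd.
  exact: set_val_continuous.
exact: flow_act_continuous.
Qed.

Definition subflow : compact_flow G.
Proof.
refine (@CompactFlow G (set_type A) subflow_act _ _ _ _ subflow_act_continuous).
- apply: compact_set_type.
  exact: subclosed_compact clA (@flow_compact _ X) _.
- by apply: hausdorff_set_type; exact: flow_hausdorff.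
- by move=> x; apply/val_inj; exact: flow_act1.
- by move=> s t x; apply/val_inj; exact: flow_actM.
Defined.

End Subflow.

(** Zorn's lemma is applied to the open complements, ordered by inclusion: by
    compactness, a chain of nonempty closed sets has a common point. *)
Lemma ex_minimal_subset : [set: X] !=set0 ->
  exists A : set X, [/\ closed A, A !=set0,
    forall t x, A x -> A (flow_act t x) &
    forall B : set X, closed B -> B !=set0 ->
      (forall t x, B x -> B (flow_act t x)) -> B `<=` A -> A `<=` B].
Proof.
move=> [x0 _].
pose P := [set U : set X | [/\ open U, ~` U !=set0 &
  forall t x, ~ U x -> ~ U (flow_act t x)]].
(* members of P are the complements of nonempty closed invariant sets *)
have [F FP totF|U [[oU U0 Uinv] Umax]] := @Zorn_bigcup X P.
  split.
  - by apply: bigcup_open => U /FP[].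
  - have [->|/set0P[U0 FU0]] := eqVneq F set0.
      by exists x0; rewrite bigcup_set0.
    have FF : ProperFilter (filter_from F (fun U => ~` U)).
      apply: filter_from_proper; last by move=> U /FP[].
      apply: filter_from_filter; first by exists U0.
      move=> U W FU FW; have [UW|WU] := totF _ _ FU FW.
        by exists W => // x nWx; split=> //; apply: contra_not nWx; exact: UW.
      by exists U => // x nUx; split=> //; apply: contra_not nUx; exact: WU.
    have [p [_ clp]] := @flow_compact _ X _ FF (filterT).
    exists p => -[U FU Up]; have [oU _ _] := FP _ FU.
    have [y [nUy Uy]] := clp (~` U) U (ex_intro2 _ _ U FU (fun _ => id))
      (open_nbhs_nbhs (conj oU Up)).
    exact: nUy.
  - move=> t x nx [U FU Utx]; have [_ _ Uinv] := FP _ FU.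
    by apply: (Uinv t x) => // Ux; apply: nx; exists U.
exists (~` U); split => //; first exact: open_closedC.
move=> B clB B0 Binv BU x nUx; apply: contrapT => nBx.
apply: (Umax (~` B)).
  split; first by apply: subsetCr; apply: BU.
  by move=> /(_ x nBx).
split; [exact: closed_openC|by rewrite setCK|].
by move=> t y /contrapT By nBy; apply: nBy; exact: Binv.
Qed.

Lemma ex_minimal_flow : [set: X] !=set0 ->
  exists Y : compact_flow G, minimal_flow Y /\ exists phi : Y -> X,
    forall t y, phi (flow_act t y) = flow_act t (phi y).
Proof.
move=> /ex_minimal_subset[A [clA [a Aa] Ainv Amin]].
exists (subflow clA Ainv); split; last by exists set_val.
split=> [|B clB [b Bb] Binv]; first by exists (SigSub (mem_set Aa)).
(* B is the trace on A of the closed set complementary to W *)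
have [W oW WB] : open (~` B) by exact: closed_openC.
have BE x : B x <-> ~ W (\val x).
  have -> : W (\val x) = (~` B) x by rewrite -WB.
  by split=> [? /(_ _)|/contrapT].
apply/seteqP; split=> // x _; apply/BE.
suff : (A `&` ~` W) (\val x) by case.
apply: (Amin (A `&` ~` W)).
- by apply: closedI => //; exact: open_closedC.
- by exists (\val b); split; [exact: set_valP|exact/BE].
- move=> t y [Ay nWy]; split; first exact: (Ainv t y Ay).
  pose y' : subflow clA Ainv := SigSub (mem_set Ay).
  exact/(BE (flow_act t y'))/Binv/BE.
- by move=> y [].
- exact: set_valP.
Qed.

End MinimalSubflow.

(** * Freeness *)

Lemma free_equivariant (G : topologicalGroupType) (X Y : Type)
    (actX : G -> X -> X) (actY : G -> Y -> Y) (phi : X -> Y) :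
  (forall t x, phi (actX t x) = actY t (phi x)) ->
  free_action actY -> free_action actX.
Proof.
by move=> phiE freeY t x tx; apply: (freeY t (phi x)); rewrite -phiE tx.
Qed.

Theorem theorem5p7 (R : realType) (G : topologicalGroupType)
    (hausdorffG : hausdorff_space G) :
  (forall t : G, t <> 1%g ->
     (exists2 V : set G, symmetric_nbhs V & qtb_at t V) ->
     t_free t (GLUC_act : G -> GLUC R G -> GLUC R G)) /\
  (locally_qtb G ->
     [/\ free_action (GLUC_act : G -> GLUC R G -> GLUC R G),
         forall X : compact_ambit G, universal_ambit X ->
           free_action (@flow_act G X) &
         forall X : compact_flow G, universal_minimal_flow X ->
           free_action (@flow_act G X)]).
Proof.
have tfree t : (exists2 V : set G, symmetric_nbhs V & qtb_at t V) ->
    t_free t (GLUC_act : G -> GLUC R G -> GLUC R G).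
  by move=> [V Vsym Vqtb]; exact: t_free_GLUC Vsym Vqtb.
split=> [t _|qtbG]; first exact: tfree.
have freeG : free_action (@flow_act G (@GLUC_flow R G)).
  move=> t x tx; apply: contrapT => t1.
  exact: (tfree t (qtbG t t1) x tx).
split; first exact: freeG.
- move=> X /(_ (@GLUC_ambit R G)) [phi [_ _ phiE] _].
  exact: free_equivariant phiE freeG.
- move=> X [_ Xuniv].
  have [|Y [Ymin [psi psiE]]] := @ex_minimal_flow G (@GLUC_flow R G).
    by exists GLUC_base.
  have [phi [_ _ phiE]] := Xuniv Y Ymin.
  exact: free_equivariant phiE (free_equivariant psiE freeG).
Qed.
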